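(* Let $\mathbb{F}$ be a commutative field of characteristic $0$ and let $f:\mathbb{R}^2 \to \mathbb{F}^2$ preserve unit distance. If $A,B,C,D \in \mathbb{R}^2$ and $|AB|=|CD|$, then $\varphi_2(f(A),f(B))=\varphi_2(f(C),f(D))$.
   Context: For $u=(u_1,u_2)$, $v=(v_1,v_2)\in\mathbb{F}^2$, $\varphi_2(u,v)=(u_1-v_1)^2+(u_2-v_2)^2\in\mathbb{F}$. A map $f:\mathbb{R}^2\to\mathbb{F}^2$ preserves unit distance if for all $x,y\in\mathbb{R}^2$, $|x-y|=1$ (Euclidean distance) implies $\varphi_2(f(x),f(y))=1$. $|AB|$ denotes the Euclidean distance between $A,B\in\mathbb{R}^2$. *)

(* Defs.v *)
From mathcomp Require Import all_boot all_order all_algebra.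
From mathcomp Require Import reals.

Set Implicit Arguments.
Unset Strict Implicit.
Unset Printing Implicit Defensive.

Import Order.TTheory GRing.Theory Num.Theory.

Local Open Scope ring_scope.

Definition phi2 (F : fieldType) (u v : F * F) : F :=
  (u.1 - v.1) ^+ 2 + (u.2 - v.2) ^+ 2.

(* The library norm on [R * R] is the max norm, so the Euclidean distance is
   written out here. *)
Definition edist (R : realType) (x y : R * R) : R :=
  Num.sqrt ((x.1 - y.1) ^+ 2 + (x.2 - y.2) ^+ 2).

Definition preserves_unit_distance (R : realType) (F : fieldType)
    (f : R * R -> F * F) : Prop :=
  forall x y : R * R, edist x y = 1 -> phi2 (f x) (f y) = 1.

(* Main.v *)
Require Import Defs.
From mathcomp Require Import all_boot all_order all_algebra.
From mathcomp Require Import reals.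
From HB Require Import structures.
From mathcomp Require Import ring lra.

(** Up to a constant, f is additive and carries orthogonal vectors to
orthogonal vectors.  That is enough: if |AB| = |CD|, then (A - B) - (C - D) and
(A - B) + (C - D) are orthogonal, and the product of their images under the
additive part L of f is phi2 (f A) (f B) - phi2 (f C) (f D).

Additivity.  In F^2, as in the Euclidean plane, two distinct points have at
most two points at unit distance from both, and these two add up to the sum of
the given points ([unit_circles_meet]).  So f maps a unit rhombus to a
parallelogram, unless it identifies two opposite vertices.  For rhombi made of
two equilateral triangles the Moser spindle rules this out ([shift_inv60]);
hence f is affine along any triangular lattice of side 1.  Such lattices contain
segments of length m and of length sqrt (m^2 + 3), and the difference of these
two lengths tends to 0: every two distinct points X, Y have a common neighbour
Z with |XZ| = m and |YZ| = sqrt (m^2 + 3), whose images have different squared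
distances to f Z.  So f is injective ([unit_preserving_inj]), no unit rhombus
collapses, and since unit vectors generate the plane, f is affine over the
integers ([shift_inv_all]).

Orthogonality.  Fix an orthonormal frame (e, e') and put g s = L (s e) and
h t = L (t e').  Comparing the unit vectors s e + t e' and s e - t e' gives
g s . h t = 0 whenever s^2 + t^2 = 1, and then whenever s^2 + t^2 is the square
of a positive integer.  If t'^2 = t^2 + 1, then after a common integer scaling t
and t' both become legs of right triangles with integer hypotenuses and the same
other leg s, so that h t and h t' are orthogonal to the same nonzero vector g s
of the plane F^2 and therefore parallel ([cross_sqrt_step]).  So the relation
that h x and h y are parallel is compatible with sums and links x to
sqrt (x^2 + 1) and to 1/x; these operations lead from any t to 1
([cross_one]).  Hence h is valued in the line of h 1, likewise g in the line of
g 1, and g 1 . h 1 = 0 because (3, 4, 5) is a Pythagorean triple. *)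

Set Implicit Arguments.
Unset Strict Implicit.
Unset Printing Implicit Defensive.

Import Order.TTheory GRing.Theory Num.Theory.

Local Open Scope ring_scope.

(** * Plane vectors over a commutative ring *)

Definition dot (K : comNzRingType) (u v : K * K) : K := u.1 * v.1 + u.2 * v.2.
Definition cross (K : comNzRingType) (u v : K * K) : K := u.1 * v.2 - u.2 * v.1.
(** Multiplication of complex numbers: [cmul z] is the similarity with matrix
rows (z.1, - z.2) and (z.2, z.1), a rotation when [dot z z = 1]. *)
Definition cmul (K : comNzRingType) (z v : K * K) : K * K :=
  (z.1 * v.1 - z.2 * v.2, z.2 * v.1 + z.1 * v.2).

Definition scale (K : comNzRingType) (s : K) (v : K * K) : K * K :=
  (s * v.1, s * v.2).

Definition perp (K : comNzRingType) (u : K * K) : K * K := (- u.2, u.1).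

Lemma pair_ext (K : Type) (u v : K * K) : u.1 = v.1 -> u.2 = v.2 -> u = v.
Proof. by case: u v => [? ?] [? ?] /= -> ->. Qed.

Lemma fstMn (K : comNzRingType) (u : K * K) n : (u *+ n).1 = n%:R * u.1.
Proof. by rewrite raddfMn mulr_natl. Qed.

Lemma sndMn (K : comNzRingType) (u : K * K) n : (u *+ n).2 = n%:R * u.2.
Proof. by rewrite raddfMn mulr_natl. Qed.

Lemma dotC (K : comNzRingType) (u v : K * K) : dot u v = dot v u.
Proof. by rewrite /dot /=; ring. Qed.

Lemma dot_perp (K : comNzRingType) (u : K * K) : dot (perp u) (perp u) = dot u u.
Proof. by rewrite /dot /=; ring. Qed.

Lemma dot_cmul (K : comNzRingType) (z u v : K * K) :
  dot (cmul z u) (cmul z v) = dot z z * dot u v.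
Proof. by rewrite /dot /cmul /=; ring. Qed.

Lemma dotMn (K : comNzRingType) (u v : K * K) n :
  dot (u *+ n) (v *+ n) = (n * n)%:R * dot u v.
Proof. by rewrite /dot /= !fstMn !sndMn natrM; ring. Qed.

Lemma dotDMn (K : comNzRingType) (a b : K * K) n m :
  dot (a *+ n + b *+ m) (a *+ n + b *+ m) =
    (n%:R * n%:R + n%:R * m%:R) * dot a a + (m%:R * m%:R + n%:R * m%:R) * dot b b
    - n%:R * m%:R * dot (a - b) (a - b).
Proof. by rewrite /dot /= !fstMn !sndMn; ring. Qed.

Lemma dot_subD (K : comNzRingType) (u v : K * K) :
  dot (u - v) (u + v) = dot u u - dot v v.
Proof. by rewrite /dot /=; ring. Qed.

Lemma crossMn (K : comNzRingType) (u v : K * K) n :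
  cross (u *+ n) (v *+ n) = (n * n)%:R * cross u v.
Proof. by rewrite /cross /= !fstMn !sndMn natrM; ring. Qed.

Lemma cross_perp (K : comNzRingType) (u v : K * K) : cross u (perp v) = dot u v.
Proof. by rewrite /cross /dot /=; ring. Qed.

Lemma scale_inj (K : comNzRingType) (e : K * K) :
  dot e e = 1 -> injective (fun s => scale s e).
Proof.
move=> ee s t /(congr1 (dot e)).
have E r : dot e (scale r e) = r * dot e e by rewrite /dot /=; ring.
by rewrite !E ee !mulr1.
Qed.

(** Parallelism through a nonzero vector; [v] may be isotropic, which is why
this is an identity between 2 x 2 determinants and not a projection. *)
Lemma cross_trans (K : fieldType) (u v w : K * K) :
  v != 0 -> cross u v = 0 -> cross v w = 0 -> cross u w = 0.
Proof.
move=> v0 uv vw.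
have e1 : v.1 * cross u w = 0.
  by transitivity (w.1 * cross u v + u.1 * cross v w);
    [rewrite /cross; ring | rewrite uv vw !mulr0 addr0].
have e2 : v.2 * cross u w = 0.
  by transitivity (w.2 * cross u v + u.2 * cross v w);
    [rewrite /cross; ring | rewrite uv vw !mulr0 addr0].
apply/eqP; apply: contraNT v0 => c0; apply/eqP; apply: pair_ext; apply: (mulIf c0);
  by rewrite ?e1 ?e2 mul0r.
Qed.

Lemma cross_dot (K : fieldType) (u v w : K * K) :
  v != 0 -> cross u v = 0 -> dot v w = 0 -> dot u w = 0.
Proof. by rewrite -!cross_perp; apply: cross_trans. Qed.

(** The orthogonal of a nonzero vector of a plane is a line, even when the vector
is isotropic and lies on that line. *)
Lemma dot0_cross (K : fieldType) (a u v : K * K) :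
  a != 0 -> dot a u = 0 -> dot a v = 0 -> cross u v = 0.
Proof.
move=> a0 au av; apply: (@cross_trans _ _ (perp a)).
- apply: contra a0 => /eqP[/eqP]; rewrite oppr_eq0 => /eqP e2 e1.
  by apply/eqP; apply: pair_ext.
- by rewrite cross_perp dotC.
- by rewrite -[RHS]oppr0 -av /cross /dot /=; ring.
Qed.

Lemma dotD_unit60 (K : fieldType) (u w : K * K) : dot u u = 1 -> dot w w = 1 ->
  dot (u - w) (u - w) = 1 -> dot (u + w) (u + w) = 3%:R.
Proof.
move=> uu ww uw.
transitivity (2%:R * dot u u + 2%:R * dot w w - dot (u - w) (u - w)).
  by rewrite /dot /=; ring.
by rewrite uu ww uw; ring.
Qed.

Lemma dot_gt0 (R : realType) (v : R * R) : v != 0 -> 0 < dot v v.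
Proof.
move=> v0; rewrite lt_def /dot -!expr2 addr_ge0 ?sqr_ge0 // andbT.
apply: contra v0; rewrite paddr_eq0 ?sqr_ge0 // !sqrf_eq0 => /andP[/eqP a /eqP b].
by apply/eqP; apply: pair_ext.
Qed.

Lemma phi2_dot (F : fieldType) (u v : F * F) : phi2 u v = dot (u - v) (u - v).
Proof. by rewrite /phi2 /dot !expr2. Qed.

Lemma natf_neq0_char0 (F : fieldType) :
  [pchar F] =i pred0 -> forall n, (n.+1%:R : F) != 0.
Proof. by move=> /pcharf0P F0 n; rewrite F0. Qed.

(** * Images of unit rhombi *)

(** Besides 0 and [a + b], no point is at unit distance from both [a] and [b].
This is Euclidean geometry even when F^2 has isotropic vectors, because [a - b] is
never one of them: it would be orthogonal to [a], hence parallel to [perp a],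
which has square 1. *)
Lemma unit_circles_meet (F : fieldType) (a b m : F * F) :
  (2%:R : F) != 0 ->
  dot a a = 1 -> dot b b = 1 -> dot (m - a) (m - a) = 1 ->
  dot (m - b) (m - b) = 1 -> a != b -> m = 0 \/ m = a + b.
Proof.
move=> F2 aa bb ma mb ab.
(* Coordinates of [m] and [b] in the orthonormal frame ([a], [perp a]). *)
pose x := dot a m; pose y := cross a m; pose c := dot a b; pose s := cross a b.
have inj (u v : F * F) : dot a u = dot a v -> cross a u = cross a v -> u = v.
  have E (p : F * F) : p.1 = a.1 * dot a p - a.2 * cross a p /\
                       p.2 = a.2 * dot a p + a.1 * cross a p.
    split; rewrite -[LHS]mul1r -aa /dot /cross; ring.
  have [[u1 u2] [v1 v2]] := (E u, E v).
  by move=> e1 e2; apply: pair_ext; [rewrite u1 v1 e1 e2 | rewrite u2 v2 e1 e2].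
have cs : c * c + s * s = 1.
  by rewrite -[RHS]mulr1 -{1}aa -bb /c /s /dot /cross; ring.
have xy : x * x + y * y = 2%:R * x.
  have -> : x * x + y * y = dot m m.
    by rewrite -[RHS]mul1r -aa /x /y /dot /cross; ring.
  have : dot m m - 2%:R * x + dot a a = 1 by rewrite -[RHS]ma /x /dot /=; ring.
  by rewrite aa => /(canRL (addrK _)); rewrite subrr => /subr0_eq.
have cxsy : c * x + s * y = x.
  have E : c * x + s * y = dot b m.
    by rewrite -[RHS]mul1r -aa /c /s /x /y /dot /cross; ring.
  have : dot m m - 2%:R * dot b m + dot b b = dot m m - 2%:R * x + dot a a.
    by transitivity (1 : F); [rewrite -[RHS]mb|rewrite -[LHS]ma]; rewrite /x /dot /=; ring.
  by rewrite aa bb E => /addIr /addrI /oppr_inj /(mulfI F2).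
have aE : dot a (a + b) = 1 + c by rewrite -aa /c /dot /=; ring.
have aC : cross a (a + b) = s by rewrite /s /cross /=; ring.
have ca : cross a a = 0 by rewrite /cross; ring.
have a0 : dot a 0 = 0 by rewrite /dot /=; ring.
have c0 : cross a 0 = 0 by rewrite /cross /=; ring.
have [s0|s0] := eqVneq s 0.
  have cN : c = -1.
    move: cs; rewrite s0 mulr0 addr0 -expr2 => /eqP; rewrite sqrf_eq1 => /orP[]/eqP // c1.
    by case/eqP: ab; apply: inj; rewrite ?ca // aa -/c c1.
  have x0 : x = 0.
    move: cxsy; rewrite cN s0 mul0r addr0 mulN1r => /eqP.
    rewrite eq_sym -subr_eq0 opprK -mulr2n -mulr_natl mulf_eq0 (negPf F2) /=.
    by move/eqP.
  left; apply: inj; rewrite ?a0 ?c0 // -/y.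
  by move: xy; rewrite x0 !mulr0 add0r => /eqP; rewrite mulf_eq0 orbb => /eqP.
have c1 : 1 - c != 0.
  apply: contra s0 => /eqP/subr0_eq c1; move: cs; rewrite -c1 mulr1.
  by move/(canRL (addKr _)); rewrite addNr => /eqP; rewrite mulf_eq0 orbb.
have sy : s * y = (1 - c) * x by transitivity (x - c * x); [rewrite -[X in X - _]cxsy|]; ring.
(* Eliminating [y] leaves a quadratic equation for [x] with roots 0 and [1 + c]. *)
have : 2%:R * ((1 - c) * (x * (x - (1 + c)))) = 0.
  have -> : 2%:R * ((1 - c) * (x * (x - (1 + c)))) =
     s * s * (x * x + y * y - 2%:R * x) - (s * y - (1 - c) * x) * (s * y + (1 - c) * x)
     + (c * c + s * s - 1) * (2%:R * x - x * x) by ring.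
  by rewrite xy sy cs; ring.
move=> /eqP; rewrite !mulf_eq0 (negPf F2) (negPf c1) /= => /orP[/eqP x0|].
  left; apply: inj; rewrite ?a0 ?c0 //; apply: (mulfI s0).
  by rewrite -/y sy x0 !mulr0.
rewrite subr_eq0 => /eqP x1; right; apply: inj; first by rewrite aE -x1.
apply: (mulfI s0); rewrite aC -/y sy x1.
by transitivity (1 - c * c); [|rewrite -[X in X - _]cs]; ring.
Qed.

Lemma preserves_unit_dot (R : realType) (F : fieldType) (f : R * R -> F * F) :
  preserves_unit_distance f ->
  forall x y, dot (x - y) (x - y) = 1 -> dot (f x - f y) (f x - f y) = 1.
Proof.
move=> hf x y xy; rewrite -phi2_dot; apply: hf; rewrite /edist.
by rewrite !expr2; move: xy; rewrite /dot /= => ->; rewrite sqrtr1.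
Qed.

Lemma preserves_unit_step (R : realType) (F : fieldType) (f : R * R -> F * F) :
  preserves_unit_distance f -> forall x u, dot u u = 1 ->
  dot (f (x + u) - f x) (f (x + u) - f x) = 1.
Proof.
by move=> hf x u uu; apply: preserves_unit_dot => //; rewrite addrAC subrr add0r.
Qed.

Lemma rhombus_image (R : realType) (F : fieldType) (f : R * R -> F * F) :
  (2%:R : F) != 0 -> preserves_unit_distance f ->
  forall x u w, dot u u = 1 -> dot w w = 1 -> f (x + u) != f (x + w) ->
  f (x + u + w) = f x \/
  f (x + u + w) - f x = (f (x + u) - f x) + (f (x + w) - f x).
Proof.
move=> F2 hf x u w uu ww ne.
case: (@unit_circles_meet F (f (x + u) - f x) (f (x + w) - f x) (f (x + u + w) - f x)) => //.
- exact: preserves_unit_step.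
- exact: preserves_unit_step.
- by rewrite opprB addrA subrK; apply: preserves_unit_step.
- by rewrite opprB addrA subrK addrAC; apply: preserves_unit_step.
- by apply: contra ne => /eqP/addIr->.
- by move/subr0_eq; left.
- by right.
Qed.

(** The increment of [f] along [u] does not change under translation by [v]; the
aim is to reach this for all [u] and [v], which makes [f - f 0] additive. *)
Definition shift_inv (R F : zmodType) (f : R -> F) (u v : R) :=
  forall x, f (x + v + u) - f (x + v) = f (x + u) - f x.

Lemma shift_invC (R F : zmodType) (f : R -> F) u v :
  shift_inv f u v -> shift_inv f v u.
Proof.
move=> H x; have /eqP := H x; rewrite subr_eq addrAC => /eqP ->.
by rewrite [_ + f (x + v)]addrC -addrA; congr (_ + _); rewrite addrAC subrr add0r.
Qed.

Lemma parallelogram_shift (R F : zmodType) (f : R -> F) u w x :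
  f (x + u + w) - f x = (f (x + u) - f x) + (f (x + w) - f x) ->
  f (x + u + w) - f (x + u) = f (x + w) - f x.
Proof.
move=> e.
have -> : f (x + u + w) - f (x + u) = (f (x + u + w) - f x) - (f (x + u) - f x).
  by rewrite opprB addrA subrK.
by rewrite e addrAC subrr add0r.
Qed.

Lemma shift_invD (R F : zmodType) (f : R -> F) u v w :
  shift_inv f u v -> shift_inv f u w -> shift_inv f u (v + w).
Proof. by move=> uv uw x; rewrite addrA uw uv. Qed.

Lemma shift_inv0 (R F : zmodType) (f : R -> F) u : shift_inv f u 0.
Proof. by move=> x; rewrite addr0. Qed.

Lemma shift_invN (R F : zmodType) (f : R -> F) u v :
  shift_inv f u v -> shift_inv f u (- v).
Proof. by move=> uv x; rewrite -(uv (x - v)) subrK. Qed.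

Lemma shift_invMn (R F : zmodType) (f : R -> F) u v n :
  shift_inv f u v -> shift_inv f u (v *+ n).
Proof.
move=> uv; elim: n => [|n IH]; first exact: shift_inv0.
by rewrite mulrSr; apply: shift_invD.
Qed.

Lemma shift_inv_walk (R F : zmodType) (f : R -> F) u x n :
  shift_inv f u u -> f (x + u *+ n) - f x = (f (x + u) - f x) *+ n.
Proof.
move=> uu; elim: n => [|n IH]; first by rewrite addr0 subrr.
rewrite mulrSr addrA -(subrK (f (x + u *+ n)) (f (x + u *+ n + u))).
by rewrite (shift_invMn n uu) -addrA IH mulrS.
Qed.

(** * Triangular lattices of side 1 *)

(** Two equilateral triangles glued along an edge have opposite vertices at
distance [sqrt 3].  If f identified them, then turning the figure about [x] until
its far vertex has moved by 1 (the Moser spindle) would give a second copy whose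
opposite vertices have images at squared distance 1, whereas only 0 and 3 are
possible. *)
Lemma shift_inv60 (R : realType) (F : fieldType) (f : R * R -> F * F) :
  [pchar F] =i pred0 -> preserves_unit_distance f ->
  forall u w, dot u u = 1 -> dot w w = 1 -> dot (u - w) (u - w) = 1 ->
  shift_inv f u w.
Proof.
move=> F0 hf; have nz := natf_neq0_char0 F0.
have dot0 : dot (0 : F * F) 0 = 0 by rewrite /dot /=; ring.
have step x u w : dot u u = 1 -> dot w w = 1 -> dot (u - w) (u - w) = 1 ->
    dot (f (x + u) - f (x + w)) (f (x + u) - f (x + w)) = 1.
  by move=> *; apply: preserves_unit_dot; rewrite // opprD addrACA subrr add0r.
have rhomb x u w : dot u u = 1 -> dot w w = 1 -> dot (u - w) (u - w) = 1 ->
    f (x + u + w) = f x \/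
    f (x + u + w) - f x = (f (x + u) - f x) + (f (x + w) - f x).
  move=> uu ww uw; apply: (rhombus_image (nz 1%N) hf) => //.
  apply/eqP => e; move: (step x u w uu ww uw); rewrite e subrr dot0 => /esym/eqP.
  by rewrite (negPf (nz 0%N)).
have norm3 x u w : dot u u = 1 -> dot w w = 1 -> dot (u - w) (u - w) = 1 ->
    f (x + u + w) = f x \/
    dot (f (x + u + w) - f x) (f (x + u + w) - f x) = 3%:R.
  move=> uu ww uw; case: (rhomb x u w uu ww uw) => [|->]; first by left.
  right; apply: dotD_unit60; try exact: preserves_unit_step.
  by rewrite opprB addrA subrK; apply: step.
move=> u w uu ww uw; apply: shift_invC => x.
case: (rhomb x u w uu ww uw) => [e|e]; last first.
  exact: parallelogram_shift.
exfalso.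
(* Cosine and sine of the angle whose chord in the circle of radius [sqrt 3] is
1: [3 * ((1 - 5/6)^2 + 11/36) = 1]. *)
pose z : R * R := (5 / 6, Num.sqrt 11 / 6).
have s11 : Num.sqrt 11 * Num.sqrt 11 = 11 :> R by rewrite -expr2 sqr_sqrtr.
have zz : dot z z = 1 by rewrite /dot /z /=; field: s11.
have cD (a b : R * R) : cmul z (a - b) = cmul z a - cmul z b.
  by apply: pair_ext; rewrite /cmul /=; ring.
have zu : dot (cmul z u) (cmul z u) = 1 by rewrite dot_cmul zz uu mulr1.
have zw : dot (cmul z w) (cmul z w) = 1 by rewrite dot_cmul zz ww mulr1.
have zuw : dot (cmul z u - cmul z w) (cmul z u - cmul z w) = 1.
  by rewrite -cD dot_cmul zz uw mulr1.
have turned : dot (f (x + cmul z u + cmul z w) - f x) (f (x + cmul z u + cmul z w) - f x) = 1.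
  rewrite -e; apply: preserves_unit_dot => //.
  have -> : x + cmul z u + cmul z w - (x + u + w) = cmul (z.1 - 1, z.2) (u + w).
    by apply: pair_ext; rewrite /cmul /=; ring.
  by rewrite dot_cmul dotD_unit60 // /dot /z /=; field: s11.
case: (norm3 x _ _ zu zw zuw) => d; move: turned; rewrite d.
  by rewrite subrr dot0 => /esym/eqP; rewrite (negPf (nz 0%N)).
move/eqP; rewrite -subr_eq0; have -> : 3%:R - 1 = 2%:R :> F by ring.
by rewrite (negPf (nz 1%N)).
Qed.

Definition sixty (R : realType) : R * R := (1 / 2, Num.sqrt 3 / 2).

Lemma sqrt3_sqr (R : realType) : Num.sqrt 3 * Num.sqrt 3 = 3 :> R.
Proof. by rewrite -expr2 sqr_sqrtr. Qed.

Lemma dot_sixty (R : realType) (u : R * R) : dot u u = 1 ->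
  dot (cmul (sixty R) u) (cmul (sixty R) u) = 1.
Proof.
move=> uu; rewrite dot_cmul uu mulr1 /dot /sixty /=.
by field: (sqrt3_sqr R).
Qed.

Lemma dot_sub_sixty (R : realType) (u : R * R) : dot u u = 1 ->
  dot (u - cmul (sixty R) u) (u - cmul (sixty R) u) = 1.
Proof.
move=> uu; have -> : u - cmul (sixty R) u = cmul (1 - (sixty R).1, - (sixty R).2) u.
  by apply: pair_ext; rewrite /cmul /=; ring.
by rewrite dot_cmul uu mulr1 /dot /sixty /=; field: (sqrt3_sqr R).
Qed.

(** A unit vector [u] is the sum of the two unit vectors [w] and [u - w] that make
an angle of 60 degrees with it. *)
Lemma shift_inv_self (R : realType) (F : fieldType) (f : R * R -> F * F) :
  [pchar F] =i pred0 -> preserves_unit_distance f ->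
  forall u, dot u u = 1 -> shift_inv f u u.
Proof.
move=> F0 hf u uu; pose w := cmul (sixty R) u.
rewrite -{2}(subrK w u) addrC; apply: shift_invD; apply: shift_inv60 => //.
- exact: dot_sixty.
- exact: dot_sub_sixty.
- exact: dot_sub_sixty.
by rewrite opprB addrA addrAC subrr add0r; apply: dot_sixty.
Qed.

(** With [w] at 60 degrees from [u], the vector [n u + 2 w] has squared length
[n^2 + 2 n + 4 = (n + 1)^2 + 3]: lattice directions provide lengths whose
difference to an integer is arbitrarily small. *)
Lemma triangle_walk (R : realType) (F : fieldType) (f : R * R -> F * F) :
  [pchar F] =i pred0 -> preserves_unit_distance f ->
  forall u w x n, dot u u = 1 -> dot w w = 1 -> dot (u - w) (u - w) = 1 ->
  let d := f (x + u *+ n + w *+ 2) - f x in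
  dot d d = (n * n + 2 * n + 4)%:R.
Proof.
move=> F0 hf u w x n uu ww uw d.
have su := shift_inv_self F0 hf uu; have sw := shift_inv_self F0 hf ww.
pose a := f (x + u) - f x; pose b := f (x + w) - f x.
have dE : d = a *+ n + b *+ 2.
  rewrite /d -(subrK (f (x + u *+ n)) (f (x + u *+ n + w *+ 2))).
  rewrite shift_inv_walk // (shift_invMn n (shift_invC (shift_inv60 F0 hf uu ww uw))).
  by rewrite -addrA shift_inv_walk // addrC.
have aa : dot a a = 1 by apply: preserves_unit_step.
have bb : dot b b = 1 by apply: preserves_unit_step.
have ab : dot (a - b) (a - b) = 1.
  rewrite opprB addrA subrK; apply: preserves_unit_dot => //.
  by rewrite opprD addrACA subrr add0r.
by rewrite dE dotDMn aa bb ab !natrD !natrM; ring.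
Qed.

(** * Injectivity *)

(** A triangle with base [V] and sides [m], [sqrt (m^2 + 3)] exists once [m] is
large, since the difference of the two sides must not exceed the base.  The apex
is given by its complex ratio [z] to [V], so that the sides are [z V] and
[(z - 1) V]. *)
Lemma exists_far_apex (R : realType) (V : R * R) : V != 0 ->
  exists n z, dot (cmul z V) (cmul z V) = n.+1%:R ^+ 2 /\
    dot (cmul (z.1 - 1, z.2) V) (cmul (z.1 - 1, z.2) V) = n.+1%:R ^+ 2 + 3%:R.
Proof.
move=> V0; pose N := dot V V.
have N0 : 0 < N := dot_gt0 V0.
(* The real part is forced by the difference 3 of the squared sides. *)
pose k1 := (N - 3) / (2 * N).
pose n := Num.truncn (k1 ^+ 2 * N).
have nP : k1 ^+ 2 * N < n.+1%:R by apply: truncnS_gt.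
have n2 : n.+1%:R <= n.+1%:R ^+ 2 :> R by rewrite expr2 -natrM ler_nat leq_pmulr.
pose k2 := Num.sqrt (n.+1%:R ^+ 2 / N - k1 ^+ 2).
have k2E : k2 * k2 = n.+1%:R ^+ 2 / N - k1 ^+ 2.
  rewrite -expr2 sqr_sqrtr // subr_ge0 ler_pdivlMr //.
  by apply: le_trans n2; apply: ltW.
have Nne : N != 0 by rewrite gt_eqF.
exists n, (k1, k2); rewrite !dot_cmul -/N /dot /= k2E /k1.
by split; field.
Qed.

(** If [X] and [Y] had the same image, the apex [Z] of the triangle above, reached
from [X] by [n + 1] unit steps and from [Y] by a walk along a triangular lattice,
would give [(n + 1)^2 = (n + 1)^2 + 3] in F. *)
Lemma unit_preserving_inj (R : realType) (F : fieldType) (f : R * R -> F * F) :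
  [pchar F] =i pred0 -> preserves_unit_distance f -> injective f.
Proof.
move=> F0 hf X Y fXY; apply/eqP/negPn/negP => XY.
have nz := natf_neq0_char0 F0.
have V0 : Y - X != 0 by rewrite subr_eq0 eq_sym.
have [n [z [zV zV1]]] := exists_far_apex V0.
have m0 : n.+1%:R != 0 :> R by rewrite pnatr_eq0.
have nE : n%:R = n.+1%:R - 1 :> R by rewrite -natr1 addrK.
have [m mE] : exists m : R, m = n.+1%:R by exists n.+1%:R.
rewrite -mE in m0 nE zV zV1.
have m3 : m ^+ 2 + 3 != 0 by rewrite gt_eqF // ltr_wpDl ?sqr_ge0.
pose u := cmul (m^-1, 0) (cmul z (Y - X)).
(* [u' = (Z - Y) / (m + i sqrt 3)], and [m + i sqrt 3] is [n + 2 * sixty] in the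
complex plane. *)
pose u' := cmul (m / (m ^+ 2 + 3), - Num.sqrt 3 / (m ^+ 2 + 3)) (cmul (z.1 - 1, z.2) (Y - X)).
have uu : dot u u = 1 by rewrite dot_cmul zV /dot /=; field.
have s3 := sqrt3_sqr R.
have uu' : dot u' u' = 1.
  by rewrite dot_cmul zV1 /dot /=; field: s3.
have Z : Y + u' *+ n + (cmul (sixty R) u') *+ 2 = X + u *+ n.+1.
  apply: pair_ext; rewrite /= ?fstMn ?sndMn -mE nE /u' /u /cmul /sixty /=;
  by field: s3; rewrite m3 m0.
have := triangle_walk F0 hf Y n uu' (dot_sixty uu') (dot_sub_sixty uu').
rewrite /= Z -fXY shift_inv_walk; last exact: shift_inv_self.
set a := f (X + u) - f X.
rewrite dotMn preserves_unit_step // mulr1.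
have -> : (n * n + 2 * n + 4 = n.+1 * n.+1 + 3)%N by ring.
rewrite natrD -{1}(addr0 (_ * _)%:R) => /addrI/esym/eqP.
by rewrite (negPf (nz 2%N)).
Qed.

(** * Additivity *)

Lemma shift_inv_unit (R : realType) (F : fieldType) (f : R * R -> F * F) :
  [pchar F] =i pred0 -> preserves_unit_distance f ->
  forall u w, dot u u = 1 -> dot w w = 1 -> shift_inv f u w.
Proof.
move=> F0 hf u w uu ww; have inj := unit_preserving_inj F0 hf.
have [->|ne] := eqVneq u w; first exact: shift_inv_self.
have [->|ne'] := eqVneq w (- u); first by apply/shift_invN/shift_inv_self.
apply: shift_invC => x.
have fne : f (x + u) != f (x + w) by apply: contra ne => /eqP/inj/addrI ->.
case: (rhombus_image (natf_neq0_char0 F0 1%N) hf uu ww fne) => e.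
  move: e; rewrite -addrA -{2}(addr0 x) => /inj/addrI/eqP.
  by rewrite addrC addr_eq0 (negPf ne').
exact: parallelogram_shift.
Qed.

(** A vector of length at most 2 is a sum of two unit vectors, and every vector is
an integer multiple of such a short one. *)
Lemma unit_vectors_generate (R : realType) (P : R * R -> Prop) :
  (forall u, dot u u = 1 -> P u) ->
  (forall v w, P v -> P w -> P (v + w)) -> forall v, P v.
Proof.
move=> Pu PD v.
have short p : dot p p <= 4 -> P p.
  have [->|p0] := eqVneq p 0 => p4.
    by rewrite -(subrr (1, 0)); apply: PD; apply: Pu; rewrite /dot /=; ring.
  have N0 := dot_gt0 p0.
  pose k := Num.sqrt ((dot p p)^-1 - 4^-1).
  have kk : k * k = (dot p p)^-1 - 4^-1.
    by rewrite -expr2 sqr_sqrtr // subr_ge0 lef_pV2 ?posrE.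
  have -> : p = cmul (1 / 2, k) p + cmul (1 / 2, - k) p.
    by apply: pair_ext; rewrite /cmul /=; field.
  have Nne : dot p p != 0 by rewrite gt_eqF.
  by apply: PD; apply: Pu; rewrite dot_cmul {1}/dot /= ?mulrNN kk; field.
pose n := Num.truncn (dot v v).
pose q := cmul (n.+1%:R^-1, 0) v.
have n0 : n.+1%:R != 0 :> R by rewrite pnatr_eq0.
have -> : v = q *+ n.+1.
  by apply: pair_ext; rewrite ?fstMn ?sndMn /= mul0r ?subr0 ?add0r mulVKf.
have Pq : P q.
  apply: short; rewrite dot_cmul {1}/dot /= mulr0 addr0 -invfM mulrC ler_pdivrMr ?mulr_gt0 //.
  have := ltW (truncnS_gt (dot v v)); rewrite -/n => /le_trans-> //.
  by rewrite -!natrM ler_nat mulnA leq_pmull.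
have mult m : P (q *+ m.+1).
  by elim: m => [|m IH]; rewrite ?mulr1n // mulrS; apply: PD.
exact: mult.
Qed.

Lemma shift_inv_all (R : realType) (F : fieldType) (f : R * R -> F * F) :
  [pchar F] =i pred0 -> preserves_unit_distance f ->
  forall v w, shift_inv f v w.
Proof.
move=> F0 hf v w.
have unit_shift u : dot u u = 1 -> shift_inv f u w.
  move=> uu; move: w; apply: unit_vectors_generate => [w|v' w]; last exact: shift_invD.
  exact: shift_inv_unit.
move: v; apply: unit_vectors_generate => // v v' wv wv'.
by apply: shift_invC; apply: shift_invD; apply: shift_invC.
Qed.

(** * Orthogonality on two perpendicular axes *)

Lemma circle_orth_nat (R : realType) (F : fieldType) (g h : {additive R -> F * F}) :
  [pchar F] =i pred0 ->
  (forall s t, s * s + t * t = 1 -> dot (g s) (h t) = 0) ->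
  forall s t n, s * s + t * t = n.+1%:R ^+ 2 -> dot (g s) (h t) = 0.
Proof.
move=> F0 circ s t n st; have n0 : n.+1%:R != 0 :> R by rewrite pnatr_eq0.
have E (p : R) : p = (p / n.+1%:R) *+ n.+1 by rewrite -mulr_natr divfK.
rewrite (E s) (E t) !raddfMn dotMn circ ?mulr0 //.
transitivity ((s * s + t * t) / n.+1%:R ^+ 2); first by rewrite expr2 invfM; ring.
by rewrite st divff // expf_neq0.
Qed.

(** The vector [g s] is orthogonal to both [h (2 j t)] and [h (2 j t')] as soon as
[s^2 + (2 j t)^2 = (j^2 - 1)^2] and [s^2 + (2 j t')^2 = (j^2 + 1)^2].  These two
equations are the same one because [t'^2 - t^2 = 1], and it has a solution [s]
when [j] is large. *)
Lemma cross_sqrt_step (R : realType) (F : fieldType) (g h : {additive R -> F * F}) :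
  [pchar F] =i pred0 -> injective g ->
  (forall s t, s * s + t * t = 1 -> dot (g s) (h t) = 0) ->
  forall t t', t' * t' = t * t + 1 -> cross (h t) (h t') = 0.
Proof.
move=> F0 ginj circ t t' tt'; have orth := circle_orth_nat F0 circ.
pose m := Num.truncn (2 * `|t|); pose j := m.+2.
have jP : 2 * `|t| < j%:R - 1 by rewrite /j -(@natr1 R m.+1) addrK; apply: truncnS_gt.
have j2 : 2 <= j%:R :> R by rewrite ler_nat.
have t0 : 0 <= `|t| by [].
have tE : `|t| * `|t| = t * t by rewrite -normrM ger0_norm // -expr2 sqr_ge0.
have pos : 0 < (j%:R * j%:R - 1) ^+ 2 - 4 * j%:R * j%:R * (t * t) :> R.
  rewrite -tE.
  have : 0 < (j%:R * j%:R - 1 - 2 * j%:R * `|t|) * (j%:R * j%:R - 1 + 2 * j%:R * `|t|).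
    by apply: mulr_gt0; nra.
  by congr (_ < _); ring.
pose s := Num.sqrt ((j%:R * j%:R - 1) ^+ 2 - 4 * j%:R * j%:R * (t * t)).
have sE : s * s = (j%:R * j%:R - 1) ^+ 2 - 4 * j%:R * j%:R * (t * t).
  by rewrite -expr2 sqr_sqrtr // ltW.
have gs0 : g s != 0.
  by rewrite -(raddf0 g) (inj_eq ginj) gt_eqF // sqrtr_gt0.
have jE : (j * j)%N = (j * j).-2.+2 by [].
have jj : (j * j).-2.+1%:R = j%:R * j%:R - 1 :> R.
  by rewrite -natrM [X in _ = X%:R - 1]jE -[X in _ = X - 1]natr1 addrK.
have o1 : dot (g s) (h (t *+ (2 * j))) = 0.
  by apply: (orth _ _ (j * j).-2); rewrite jj sE -[t *+ _]mulr_natl natrM; ring.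
have o2 : dot (g s) (h (t' *+ (2 * j))) = 0.
  apply: (orth _ _ (j * j)%N); rewrite sE -[t' *+ _]mulr_natl natrM -(@natr1 R (j * j)) natrM.
  have -> : 2%:R * j%:R * t' * (2%:R * j%:R * t') = 4 * j%:R * j%:R * (t' * t') by ring.
  by rewrite tt'; ring.
have := dot0_cross gs0 o1 o2; rewrite !raddfMn crossMn => /eqP.
rewrite mulf_eq0 => /orP[|/eqP] //.
by rewrite ((pcharf0P F).1 F0).
Qed.

(** [(y + 1/y) / 2] and [(y - 1/y) / 2] have squares that differ by 1, and their
sum and difference are [y] and [1/y]. *)
Lemma cross_inv (R : realType) (F : fieldType) (g h : {additive R -> F * F}) :
  [pchar F] =i pred0 -> injective g ->
  (forall s t, s * s + t * t = 1 -> dot (g s) (h t) = 0) ->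
  forall y, y != 0 -> cross (h y) (h y^-1) = 0.
Proof.
move=> F0 ginj circ y y0; pose t := (y - y^-1) / 2; pose t' := (y + y^-1) / 2.
have tt' : t' * t' = t * t + 1 by rewrite /t /t'; field.
have -> : h y^-1 = h t' - h t by rewrite -raddfB; congr (h _); rewrite /t /t'; field.
have -> : h y = h t + h t' by rewrite -raddfD; congr (h _); rewrite /t /t'; field.
transitivity (2%:R * cross (h t) (h t')); first by rewrite /cross /=; ring.
by rewrite (cross_sqrt_step F0 ginj circ tt') mulr0.
Qed.

(** The set V of all x with [h x] parallel to [h t] is stable under sums,
differences, inverses and [x |-> sqrt (x^2 + 1)].  Put [w = sqrt (1 + t^-2)].  Then V
contains [t], [w] and [t w = sqrt (t^2 + 1)], hence
[t / w = t w - 1 / (t w)] and [w / t].  By Hua's identity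
[a - 1 / (1/a + 1 / (1/b - a)) = a b a], a set stable under these operations
contains [a b a] when it contains [a] and [b]; with [a = t + w] and
[b = 1 / (t w)] this element is [t / w + w / t + 2].  So 2, and with it 1, is
in V. *)
Lemma cross_one (R : realType) (F : fieldType) (g h : {additive R -> F * F}) :
  [pchar F] =i pred0 -> injective g -> injective h ->
  (forall s t, s * s + t * t = 1 -> dot (g s) (h t) = 0) ->
  forall t, cross (h t) (h 1) = 0.
Proof.
move=> F0 ginj hinj circ t.
wlog t0 : t / 0 < t => [pos|].
  have [/pos //|tN|<-] := ltrgtP 0 t; last by rewrite raddf0 /cross /=; ring.
  rewrite -[RHS]oppr0 -(pos (- t)) ?oppr_gt0 // raddfN /cross /=; ring.
pose V x := cross (h t) (h x) = 0.
have Vt : V t by rewrite /V /cross; ring.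
have hn0 x : x != 0 -> h x != 0 by rewrite -(inj_eq hinj) raddf0.
have VD x y : V x -> V y -> V (x + y).
  rewrite /V raddfD => vx vy; transitivity (cross (h t) (h x) + cross (h t) (h y)).
    by rewrite /cross /=; ring.
  by rewrite vx vy addr0.
have VN x : V x -> V (- x).
  rewrite /V raddfN => vx; transitivity (- cross (h t) (h x)).
    by rewrite /cross /=; ring.
  by rewrite vx oppr0.
have VB x y : V x -> V y -> V (x - y) by move=> vx vy; apply/VD/VN.
have VV x : V x -> V x^-1.
  have [->|x0] := eqVneq x 0; first by rewrite invr0.
  by move=> vx; apply: cross_trans (hn0 _ x0) vx (cross_inv F0 ginj circ x0).
have VS x y : x != 0 -> y * y = x * x + 1 -> V x -> V y.
  move=> x0 xy vx.
  exact: cross_trans (hn0 _ x0) vx (cross_sqrt_step F0 ginj circ xy).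
pose w := Num.sqrt (t^-1 * t^-1 + 1).
have tne : t != 0 by rewrite gt_eqF.
have pos : 0 < t^-1 * t^-1 + 1.
  by rewrite ltr_wpDl // mulr_ge0 // invr_ge0 ltW.
have w0 : 0 < w by rewrite sqrtr_gt0.
have wne : w != 0 by rewrite gt_eqF.
have ww : w * w = t^-1 * t^-1 + 1 by rewrite -expr2 sqr_sqrtr // ltW.
have Vw : V w by apply: VS (VV _ Vt); rewrite ?invr_eq0.
have Vtw : V (t * w).
  apply: VS Vt => //; transitivity (t * t * (w * w)); first by ring.
  by rewrite ww; field.
have Vq : V (t / w).
  have -> : t / w = t * w - (t * w)^-1; last by apply/VB/VV.
  apply: (mulIf wne); transitivity (t * (w * w) - t^-1); last by field; rewrite tne wne.
  by rewrite ww; field; rewrite tne.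
have Vsq : V ((t + w) ^+ 2 / (t * w)).
  have a0 : t + w != 0 by rewrite gt_eqF // addr_gt0.
  (* Hua's identity divides by [1/b - a]; when this vanishes, [a b a = a]. *)
  have [e|ne] := eqVneq (t * w - (t + w)) 0.
    have -> : (t + w) ^+ 2 / (t * w) = t + w; last exact: VD.
    by rewrite (subr0_eq e) expr2 mulfK.
  have -> : (t + w) ^+ 2 / (t * w) = (t + w) - ((t + w)^-1 + (t * w - (t + w))^-1)^-1.
    have -> : (t + w)^-1 + (t * w - (t + w))^-1
              = (t * w) / ((t + w) * (t * w - (t + w))).
      by field; rewrite a0 ne.
    by rewrite invf_div; field; rewrite tne wne.
  by apply: (VB _ _ (VD _ _ Vt Vw)); apply/VV/VD; apply/VV; [apply/VD | apply/VB/VD].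
have V2 : V (1 + 1).
  have -> : 1 + 1 = (t + w) ^+ 2 / (t * w) - t / w - (t / w)^-1.
    by field; rewrite tne wne.
  exact: (VB _ _ (VB _ _ Vsq Vq) (VV _ Vq)).
move: V2; rewrite /V raddfD => V2.
have : 2%:R * cross (h t) (h 1) = 0 by rewrite -V2 /cross /=; ring.
by move/eqP; rewrite mulf_eq0 (negPf (natf_neq0_char0 F0 1)) => /eqP.
Qed.

(** Both [g] and [h] take their values in a line, and these lines are orthogonal
by [3^2 + 4^2 = 5^2]. *)
Lemma axes_orthogonal (R : realType) (F : fieldType) (g h : {additive R -> F * F}) :
  [pchar F] =i pred0 -> injective g -> injective h ->
  (forall s t, s * s + t * t = 1 -> dot (g s) (h t) = 0) ->
  forall s t, dot (g s) (h t) = 0.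
Proof.
move=> F0 ginj hinj circ.
have circ' s t : s * s + t * t = 1 -> dot (h s) (g t) = 0.
  by rewrite addrC => /circ; rewrite /dot [X in X + _]mulrC [X in _ + X]mulrC.
have g1h1 : dot (g 1) (h 1) = 0.
  have e : dot (g (1 *+ 3)) (h (1 *+ 4)) = 0.
    by apply: (@circle_orth_nat _ _ _ _ F0 circ _ _ 4); ring.
  rewrite !raddfMn /dot /= !fstMn !sndMn in e.
  have : 12%:R * dot (g 1) (h 1) = 0 by rewrite -e /dot; ring.
  by move/eqP; rewrite mulf_eq0 (negPf (natf_neq0_char0 F0 11)) => /eqP.
move=> s t; apply: cross_dot (cross_one F0 hinj ginj circ' s) _.
  by rewrite -(raddf0 g) (inj_eq ginj) oner_eq0.
rewrite dotC; apply: cross_dot (cross_one F0 ginj hinj circ t) _.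
  by rewrite -(raddf0 h) (inj_eq hinj) oner_eq0.
by rewrite dotC.
Qed.

(** * Equal lengths have equal images *)

Lemma polar_form (R : realType) (v : R * R) : v != 0 ->
  exists r e, [/\ r != 0, dot e e = 1 & v = scale r e].
Proof.
move=> v0; have N0 := dot_gt0 v0.
pose r := Num.sqrt (dot v v).
have rr : r * r = dot v v by rewrite -expr2 sqr_sqrtr // ltW.
have r0 : r != 0 by rewrite gt_eqF // sqrtr_gt0.
exists r, (scale r^-1 v); split=> //; last by apply: pair_ext; rewrite /= mulVKf.
transitivity (r^-1 * r^-1 * dot v v); first by rewrite /dot /=; ring.
by rewrite -rr; field.
Qed.

Lemma additive_orthogonal (R : realType) (F : fieldType) (L : {additive R * R -> F * F}) :
  [pchar F] =i pred0 -> injective L ->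
  (forall u, dot u u = 1 -> dot (L u) (L u) = 1) ->
  forall v w, dot v w = 0 -> dot (L v) (L w) = 0.
Proof.
move=> F0 Linj Lunit v w vw.
have [->|v0] := eqVneq v 0; first by rewrite raddf0 /dot /=; ring.
have [r [e [r0 ee vE]]] := polar_form v0.
have addg : zmod_morphism (fun s => L (scale s e)).
  by move=> s t; rewrite -raddfB; congr (L _); apply: pair_ext; rewrite /=; ring.
have addh : zmod_morphism (fun s => L (scale s (perp e))).
  by move=> s t; rewrite -raddfB; congr (L _); apply: pair_ext; rewrite /=; ring.
pose g : {additive R -> F * F} :=
  HB.pack (fun s => L (scale s e)) (GRing.isZmodMorphism.Build _ _ _ addg).
pose h : {additive R -> F * F} :=
  HB.pack (fun s => L (scale s (perp e))) (GRing.isZmodMorphism.Build _ _ _ addh).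
rewrite vE; have -> : w = scale (dot (perp e) w) (perp e).
  have ew : dot e w = 0.
    apply: (mulfI r0); rewrite mulr0 -[RHS]vw vE /dot /=; ring.
  apply: pair_ext; [transitivity (dot e e * w.1 - e.1 * dot e w)
                   |transitivity (dot e e * w.2 - e.2 * dot e w)];
    by [rewrite ee ew mul1r mulr0 subr0 | rewrite /dot /=; ring].
apply: (@axes_orthogonal _ _ g h F0).
- by move=> s t /Linj/(scale_inj ee).
- by move=> s t /Linj; apply: scale_inj; rewrite dot_perp.
- move=> s t st; set a := g s; set b := h t.
  have aB : dot (a + b) (a + b) = 1.
    rewrite /a /b /= -raddfD; apply: Lunit.
    transitivity ((s * s + t * t) * dot e e); first by rewrite /dot /=; ring.
    by rewrite st ee mulr1.
  have aN : dot (a - b) (a - b) = 1.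
    rewrite /a /b /= -raddfB; apply: Lunit.
    transitivity ((s * s + t * t) * dot e e); first by rewrite /dot /=; ring.
    by rewrite st ee mulr1.
  have : 4%:R * dot a b = 0.
    transitivity (dot (a + b) (a + b) - dot (a - b) (a - b)); last by rewrite aB aN subrr.
    by rewrite /dot /=; ring.
  by move/eqP; rewrite mulf_eq0 (negPf (natf_neq0_char0 F0 3)) => /eqP.
Qed.

Theorem theorem10 (R : realType) (F : fieldType) (hF : [pchar F] =i pred0)
    (f : R * R -> F * F) (hf : preserves_unit_distance f)
    (A B C D : R * R) (hABCD : edist A B = edist C D) :
  phi2 (f A) (f B) = phi2 (f C) (f D).
Proof.
have shift := shift_inv_all hF hf.
have fB x y : f (x - y) - f 0 = f x - f y.
  by have := shift (x - y) y 0; rewrite !add0r addrCA subrr addr0.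
have addL : zmod_morphism (fun v => f v - f 0).
  by move=> x y; rewrite fB opprB addrA subrK.
pose L : {additive R * R -> F * F} :=
  HB.pack (fun v => f v - f 0) (GRing.isZmodMorphism.Build _ _ _ addL).
have Linj : injective L by move=> x y /addIr /(unit_preserving_inj hF hf).
have Lunit u : dot u u = 1 -> dot (L u) (L u) = 1.
  by move=> uu; rewrite /L /= -(add0r u); apply: preserves_unit_step.
rewrite !phi2_dot -(fB A B) -(fB C D) -/(L (A - B)) -/(L (C - D)).
have ab : dot (A - B) (A - B) = dot (C - D) (C - D).
  move: hABCD; rewrite /edist => /eqP; rewrite eqr_sqrt ?addr_ge0 ?sqr_ge0 //.
  by rewrite !expr2 => /eqP.
have : dot (L (A - B - (C - D))) (L (A - B + (C - D))) = 0.
  apply: additive_orthogonal => //.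
  by rewrite dot_subD ab subrr.
by rewrite (raddfB L) (raddfD L (A - B)) dot_subD => /subr0_eq.
Qed.
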